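(* Let $d \geq 5$ and let \[ S_{4,d}(x_0,\dots,x_5) = x_0x_1^{d-1} + x_1x_2^{d-1} + x_2x_3^{d-1} + x_3x_4^{d-1} + x_4x_0^{d-1} + x_5^d. \] Then $\operatorname{sr}(S_{4,d}) = 4$.
   Context: The slice rank $\operatorname{sr}(F)$ of a homogeneous polynomial $F$ over $\mathbb{C}$ is the minimal $r$ such that $F=\sum_{k=1}^r L_k H_k$ with $L_k$ linear forms and $H_k$ homogeneous polynomials. *)

(* Defs.v *)
From HB Require Import structures.
From mathcomp Require Import all_boot all_order all_algebra.
From mathcomp Require Import complex reals.
From mathcomp Require Import mpoly.

Set Implicit Arguments.
Unset Strict Implicit.
Unset Printing Implicit Defensive.

Import GRing.Theory.
Local Open Scope ring_scope.

(* No condition is put on the degrees of the [H k]; note that the zero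
   polynomial is homogeneous of every degree. *)
Definition has_slice_decomposition (K : fieldType) (n : nat)
    (F : {mpoly K[n]}) (r : nat) : Prop :=
  exists L H : 'I_r -> {mpoly K[n]},
    [/\ forall k, L k \is 1.-homog,
        forall k, exists e : nat, H k \is e.-homog
      & F = \sum_(k < r) L k * H k].

(* [sr(F) = r], stated as a relation because a nonzero constant has no slice
   decomposition. *)
Definition is_slice_rank (K : fieldType) (n : nat)
    (F : {mpoly K[n]}) (r : nat) : Prop :=
  has_slice_decomposition F r /\
  forall s : nat, has_slice_decomposition F s -> (r <= s)%N.

Definition S4 (K : fieldType) (d : nat) : {mpoly K[6]} :=
  let x0 := 'X_(inord 0%N) in let x1 := 'X_(inord 1%N) in
  let x2 := 'X_(inord 2%N) in let x3 := 'X_(inord 3%N) in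
  let x4 := 'X_(inord 4%N) in let x5 := 'X_(inord 5%N) in
  x0 * x1 ^+ (d - 1) + x1 * x2 ^+ (d - 1) + x2 * x3 ^+ (d - 1)
  + x3 * x4 ^+ (d - 1) + x4 * x0 ^+ (d - 1) + x5 ^+ d.

(* Main.v *)
Require Import Defs.
From HB Require Import structures.
From mathcomp Require Import all_boot all_order all_algebra.
From mathcomp Require Import complex reals.
From mathcomp Require Import mpoly.
From mathcomp Require Import ring zify.

(** A decomposition with at most three slices makes the form vanish on a
    subspace [V] of dimension at least 3. Put [n = d - 1]. If [V] contains the
    axis vector [e_j], with [j <= 4], translating along it forces the two
    neighbouring coordinates to vanish on [V], which leaves a relation
    [p q^n + x5^(n+1) = 0] on a plane of [V] where [x_j = 0]; the three forms of
    such a relation have a common zero in the plane, which is then a nonzero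
    vector with all six coordinates zero. Hence [V] contains none of these axis
    vectors. Now take a plane of [V] where [x0 = 0], so that
    [x1 x2^n + x2 x3^n + x3 x4^n + x5^(n+1) = 0] on it. Suppose that [x2] and
    [x3] have a common zero [z <> 0] there. Then [x5] vanishes at [z], and
    either [x4] does as well, so that [z] is proportional to [e_1], or
    translating along [z] shows that [x3 = 0] on the plane, and a common zero of
    [x1], [x2], [x5] is proportional to [e_4]. Otherwise [x2] and [x3]
    can serve as the variables of the plane, and for [n >= 4] the terms of
    degree at most 3 in [x2] are contradictory. *)

Set Implicit Arguments.
Unset Strict Implicit.
Unset Printing Implicit Defensive.

Import GRing.Theory Num.Theory.
Local Open Scope ring_scope.

Lemma poly_eq0_of_horner (K : numDomainType) (p : {poly K}) :
  (forall x, p.[x] = 0) -> p = 0.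
Proof.
move=> p0; apply/eqP; apply: contraT => pN0.
have := max_poly_roots (rs := [seq i%:R | i <- iota 0 (size p)]) pN0.
rewrite size_map size_iota ltnn; apply.
  by apply/allP => x _; apply/eqP/p0.
by rewrite map_inj_uniq ?iota_uniq //; apply/mulrIn/oner_neq0.
Qed.

Lemma trinomial_eq0 (K : numDomainType) n (a b c : K) : (1 < n)%N ->
  (forall t, a * t ^+ n + b * t + c = 0) -> a = 0 /\ b = 0.
Proof.
move=> n1 abc0; pose P := a *: 'X^n + b *: 'X + c%:P.
have P0 : P = 0.
  apply: poly_eq0_of_horner => t.
  by rewrite /P !(hornerD, hornerZ, hornerXn, hornerX, hornerC).
have coefP k : (0 < k)%N -> a * (k == n)%:R + b * (k == 1)%:R = 0.
  move=> k0; have := congr1 (fun p : {poly K} => p`_k) P0.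
  by rewrite !coefD !coefZ coefXn coefX coefC coef0 (gtn_eqF k0) addr0.
have := coefP n (ltnW n1); have := coefP 1%N isT.
by rewrite !eqxx (gtn_eqF n1) (ltn_eqF n1) !mulr0 !mulr1 addr0 add0r.
Qed.

Lemma coef_affine_exp (K : comNzRingType) (a b : K) n k :
  ((a *: 'X + b%:P) ^+ n)`_k = a ^+ k * b ^+ (n - k) *+ 'C(n, k).
Proof.
have -> : (a *: 'X + b%:P) ^+ n
    = \poly_(i < n.+1) (a ^+ i * b ^+ (n - i) *+ 'C(n, i)).
  rewrite addrC exprDn poly_def; apply: eq_bigr => i _.
  by rewrite exprZn -polyC_exp mul_polyC scalerA scalerMnl mulrC.
by rewrite coef_poly ltnS; case: leqP => // /bin_small->.
Qed.

Lemma expr_div_mul (K : fieldType) (x y : K) k n : y != 0 -> (k <= n)%N ->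
  (x / y) ^+ k * y ^+ n = x ^+ k * y ^+ (n - k).
Proof.
move=> yN0 kn; rewrite expr_div_n -mulrA -{1}(subnKC kn) exprD.
by rewrite mulKf ?expf_neq0.
Qed.

(* If [y <> 0], eliminating [x] gives [(n+1) (n-2)^2 = (n-1)^3], that is,
   [3 n = 5]. *)
Lemma binomial_terms_eq0 (K : numDomainType) n (x y : K) : (2 < n)%N ->
  (forall k, (1 < k < 4)%N -> x ^+ k *+ 'C(n, k) = y ^+ k *+ 'C(n.+1, k)) ->
  x = 0 /\ y = 0.
Proof.
move=> n2 terms.
have ratio k : (1 < k < 4)%N -> x ^+ k * (n.+1 - k)%:R = y ^+ k * n.+1%:R.
  move=> k14; have /andP[k1 k4] := k14.
  have BN0 : 'C(n.+1, k)%:R != 0 :> K by rewrite pnatr_eq0 -lt0n bin_gt0; lia.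
  apply: (mulIf BN0); rewrite -mulrA -natrM -mul_bin_down natrM mulrCA.
  by rewrite [x ^+ k * _]mulr_natr terms // -mulr_natr; ring.
have ratio2 := ratio 2%N isT; have ratio3 := ratio 3%N isT.
suff y0 : y = 0.
  split=> //; apply/eqP; move/eqP: ratio2; rewrite y0 expr0n mul0r mulf_eq0.
  by rewrite pnatr_eq0 expf_eq0 /= subn_eq0 leqNgt ltnS (ltnW n2) orbF.
apply/eqP; apply: contraT => yN0.
have yn0 : y ^+ 6 * n.+1%:R ^+ 2 != 0.
  by rewrite mulf_neq0 ?expf_neq0 ?pnatr_eq0.
have : y ^+ 6 * n.+1%:R ^+ 2 * (n.+1 * (n.+1 - 3) ^ 2)%:R
     = y ^+ 6 * n.+1%:R ^+ 2 * ((n.+1 - 2) ^ 3)%:R.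
  rewrite natrM !natrX.
  transitivity ((y ^+ 2 * n.+1%:R) ^+ 3 * (n.+1 - 3)%:R ^+ 2); first by ring.
  transitivity ((y ^+ 3 * n.+1%:R) ^+ 2 * (n.+1 - 2)%:R ^+ 3); last by ring.
  by rewrite -ratio2 -ratio3; ring.
move/(mulfI yn0)/eqP; rewrite eqr_nat.
by case: n n2 {terms ratio ratio2 ratio3 yn0} => [|[|[|n]]] // _; lia.
Qed.

Lemma affine_powers_low_coefs_neq0 (K : numFieldType) n (a b c d : K) :
  (2 < n)%N ->
  ~ (forall k, (k < 4)%N ->
      ('X + (a *: 'X + b%:P) ^+ n + (c *: 'X + d%:P) ^+ n.+1)`_k = 0).
Proof.
move=> n2 low.
have coefE k : (k < 4)%N -> (k == 1)%:R + a ^+ k * b ^+ (n - k) *+ 'C(n, k)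
    + c ^+ k * d ^+ (n.+1 - k) *+ 'C(n.+1, k) = 0.
  by move=> k4; rewrite -!coef_affine_exp -coefX -!coefD low.
have const_coef : b ^+ n + d ^+ n.+1 = 0.
  by have := coefE 0%N isT; rewrite add0r !mul1r !bin0 !subn0.
have linear_coef : 1 + a * b ^+ (n - 1) *+ n + c * d ^+ n *+ n.+1 = 0.
  by have := coefE 1%N isT; rewrite !expr1 !bin1 subSS subn0.
have n0 : (0 < n)%N by lia.
have d_eq0 : (d == 0) = (b == 0).
  have /eqP := const_coef; rewrite addr_eq0 => /eqP/(congr1 (eq_op^~ 0)).
  by rewrite oppr_eq0 !expf_eq0 n0.
have [b0|bN0] := eqVneq b 0.
  have d0 : d = 0 by apply/eqP; rewrite d_eq0 b0.
  have /eqP := linear_coef; rewrite b0 d0 !expr0n subn_eq0.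
  rewrite leqNgt (ltnW n2) gtn_eqF //.
  by rewrite !mulr0 !mul0rn !addr0 oner_eq0.
have dN0 : d != 0 by rewrite d_eq0.
have [k /andP[k1 k4]|/eqP ab0 /eqP cd0] :=
    @binomial_terms_eq0 K n (a / b) (c / d) n2.
  apply: (mulIf (expf_neq0 n bN0)).
  rewrite !mulrnAl expr_div_mul //; last by lia.
  have -> : b ^+ n = - d ^+ n.+1 by apply/eqP; rewrite -addr_eq0 const_coef.
  rewrite mulrN expr_div_mul //; last by lia.
  apply/eqP; rewrite mulNrn -addr_eq0; apply/eqP.
  by have := coefE k k4; rewrite (gtn_eqF k1) add0r.
move: ab0 cd0 linear_coef; rewrite !mulf_eq0 !invr_eq0 (negPf bN0).
rewrite (negPf dN0) !orbF => /eqP-> /eqP-> /eqP.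
by rewrite !mul0r !mul0rn !addr0 oner_eq0.
Qed.

Section LinearForms.
Variables (K : fieldType) (vT : vectType K).
Implicit Types (V : {vspace vT}) (p q r : {scalar vT}).

Lemma hyperplane_section V p :
  exists2 W : {vspace vT}, (\dim V <= (\dim W).+1)%N &
    forall v, (v \in W) = (v \in V) && (p v == 0).
Proof.
pose f := linfun (p : {linear vT -> K^o}).
exists (V :&: lker f)%VS => [|v]; last by rewrite memv_cap memv_ker lfunE.
rewrite -(limg_ker_dim f V) -addn1 leq_add2l.
by rewrite (leq_trans (dimvS (subvf _))) // dimvf.
Qed.

Lemma exists_zero_of_form V p : (1 < \dim V)%N ->
  exists z, [/\ z \in V, z != 0 & p z = 0].
Proof.
move=> dimV; have [W dimW memW] := hyperplane_section V p.
have := memv_pick W; rewrite memW => /andP[zV /eqP pz]; exists (vpick W).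
by split; rewrite // vpick0 -dimv_eq0 -lt0n -ltnS (leq_trans dimV).
Qed.

Lemma exists_common_zero_or_dual_pair V p q : (1 < \dim V)%N ->
  (exists z, [/\ z \in V, z != 0, p z = 0 & q z = 0]) \/
  (exists v w, [/\ v \in V, w \in V, p v = 1 /\ q v = 0 & p w = 0 /\ q w = 1]).
Proof.
move=> dimV.
have [v [vV vN0 qv]] := exists_zero_of_form q dimV.
have [w [wV wN0 pw]] := exists_zero_of_form p dimV.
have [pv|pvN0] := eqVneq (p v) 0; first by left; exists v.
have [qw|qwN0] := eqVneq (q w) 0; first by left; exists w.
right; exists ((p v)^-1 *: v), ((q w)^-1 *: w).
by rewrite !rpredZ // !scalarZ qv pw !mulr0 !mulVf.
Qed.

Lemma form_shift p v x t : p v != 0 -> p (x + ((t - p x) / p v) *: v) = t.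
Proof. by move=> pv; rewrite linearD scalarZ divfK // addrC subrK. Qed.

Lemma form_shift_zero p v x t : p v = 0 -> p (x + t *: v) = p x.
Proof. by move=> pv; rewrite linearD scalarZ pv mulr0 addr0. Qed.

Lemma exists_common_zero_binomial V n p q r : (1 < \dim V)%N -> (0 < n)%N ->
  {in V, forall v, p v * q v ^+ n + r v ^+ n.+1 = 0} ->
  exists z, [/\ z \in V, z != 0 & [/\ p z = 0, q z = 0 & r z = 0]].
Proof.
move=> dimV n0 rel.
have r_eq0 v : v \in V -> p v * q v ^+ n = 0 -> r v = 0.
  by move=> /rel/[swap] ->; rewrite add0r => /eqP; rewrite expf_eq0 => /eqP.
have [z [zV zN0 pz]] := exists_zero_of_form p dimV.
have [qz|qzN0] := eqVneq (q z) 0.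
  by exists z; split; rewrite ?(r_eq0 z) ?pz ?mul0r.
have rz : r z = 0 by apply: r_eq0; rewrite ?pz ?mul0r.
have along_z v (vV : v \in V) t : p v * t ^+ n + r v ^+ n.+1 = 0.
  have := rel (v + ((t - q v) / q z) *: z).
  by rewrite form_shift // !form_shift_zero // rpredD ?rpredZ //; apply.
have r0 v : v \in V -> r v = 0.
  move=> vV; have := along_z v vV 0; rewrite expr0n gtn_eqF // mulr0 add0r.
  by move/eqP; rewrite expf_eq0 => /eqP.
have p0 v : v \in V -> p v = 0.
  by move=> vV; have := along_z v vV 1; rewrite r0 // expr1n expr0n mulr1 addr0.
have [y [yV yN0 qy]] := exists_zero_of_form q dimV.
by exists y; rewrite p0 ?r0.
Qed.

Definition jointly_injective V (x0 x1 x2 x3 x4 x5 : {scalar vT}) : Prop :=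
  {in V, forall v, x0 v = 0 -> x1 v = 0 -> x2 v = 0 -> x3 v = 0 -> x4 v = 0 ->
    x5 v = 0 -> v = 0}.

End LinearForms.

(* The chain and loop polynomials of Kreuzer and Skarke, with a Fermat term
   added. *)
Definition chain_fermat (K : pzSemiRingType) n (x1 x2 x3 x4 x5 : K) : K :=
  x1 * x2 ^+ n + x2 * x3 ^+ n + x3 * x4 ^+ n + x5 ^+ n.+1.

Definition loop_fermat (K : pzSemiRingType) n (x0 x1 x2 x3 x4 x5 : K) : K :=
  x0 * x1 ^+ n + x1 * x2 ^+ n + x2 * x3 ^+ n + x3 * x4 ^+ n + x4 * x0 ^+ n
  + x5 ^+ n.+1.

Section VanishingSubspaces.
Variables (K : numFieldType) (vT : vectType K).
Implicit Types (V : {vspace vT}).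

Lemma chain_fermat_no_dual_pair V n (x1 x2 x3 x4 x5 : {scalar vT}) v w :
    (3 < n)%N ->
  {in V, forall u, chain_fermat n (x1 u) (x2 u) (x3 u) (x4 u) (x5 u) = 0} ->
  v \in V -> w \in V -> x2 v = 1 -> x3 v = 0 -> x2 w = 0 -> x3 w = 1 -> False.
Proof.
move=> n3 vanish vV wV x2v x3v x2w x3w.
pose P := (x1 v *: 'X + (x1 w)%:P) * 'X^n
  + ('X + (x4 v *: 'X + (x4 w)%:P) ^+ n + (x5 v *: 'X + (x5 w)%:P) ^+ n.+1).
have P0 : P = 0.
  apply: poly_eq0_of_horner => t.
  have tvwE (x : {scalar vT}) : x (t *: v + w) = x v * t + x w.
    by rewrite linearD scalarZ mulrC.
  rewrite -[RHS](vanish (t *: v + w)); last by rewrite rpredD ?rpredZ.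
  rewrite /chain_fermat !tvwE x2v x3v x2w x3w /P.
  rewrite !(hornerD, hornerM, hornerZ, horner_exp, hornerX, hornerXn, hornerC).
  by rewrite mul0r mul1r addr0 add0r expr1n; ring.
apply: (@affine_powers_low_coefs_neq0 K n (x4 v) (x4 w) (x5 v) (x5 w)).
  exact: ltnW.
move=> k k4; transitivity P`_k; last by rewrite P0 coef0.
by rewrite [RHS]coefD coefMXn (leq_trans k4 n3) add0r.
Qed.

Lemma chain_fermat_common_zero V n (x1 x2 x3 x4 x5 : {scalar vT}) z :
    (1 < n)%N ->
  {in V, forall v, chain_fermat n (x1 v) (x2 v) (x3 v) (x4 v) (x5 v) = 0} ->
  z \in V -> x2 z = 0 -> x3 z = 0 ->
  x5 z = 0 /\ (x4 z = 0 \/ {in V, forall v, x3 v = 0}).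
Proof.
move=> n1 vanish zV x2z x3z.
have n0 : (n == 0)%N = false by rewrite gtn_eqF // ltnW.
have x5z : x5 z = 0.
  have := vanish z zV; rewrite /chain_fermat x2z x3z expr0n n0.
  by rewrite mulr0 !mul0r !add0r => /eqP; rewrite expf_eq0 => /eqP.
split=> //; have [x4z|x4zN0] := eqVneq (x4 z) 0; [by left | right] => v vV.
suff [] : x3 v = 0 /\ x1 z / x4 z * x2 v ^+ n = 0 by [].
apply: (@trinomial_eq0 K n _ _ ((x1 v - x4 v / x4 z * x1 z) * x2 v ^+ n
  + x2 v * x3 v ^+ n + x5 v ^+ n.+1)) => // t.
have := vanish (v + ((t - x4 v) / x4 z) *: z).
rewrite /chain_fermat form_shift // !(form_shift_zero _ _ x2z).
rewrite !(form_shift_zero _ _ x3z) (form_shift_zero _ _ x5z).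
by rewrite linearD scalarZ rpredD ?rpredZ // => <- //; ring.
Qed.

(* Along an axis vector of [x1], the form is the trinomial
   [x0 t^n + x2^n t + const] in [t = x1]. *)
Lemma loop_fermat_axis_eq0 V n (x0 x1 x2 x3 x4 x5 : {scalar vT}) :
  (2 < \dim V)%N -> (1 < n)%N -> jointly_injective V x0 x1 x2 x3 x4 x5 ->
  {in V, forall v,
    loop_fermat n (x0 v) (x1 v) (x2 v) (x3 v) (x4 v) (x5 v) = 0} ->
  {in V, forall v, x0 v = 0 -> x2 v = 0 -> x3 v = 0 -> x4 v = 0 -> x5 v = 0 ->
    v = 0}.
Proof.
move=> dimV n1 inj vanish e eV x0e x2e x3e x4e x5e; apply: (inj) => //.
apply/eqP; apply: contraT => x1e.
have x02 v : v \in V -> x0 v = 0 /\ x2 v = 0.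
  move=> vV; suff [-> /eqP] : x0 v = 0 /\ x2 v ^+ n = 0.
    by rewrite expf_eq0 => /andP[_ /eqP].
  apply: (@trinomial_eq0 K n _ _ (x2 v * x3 v ^+ n + x3 v * x4 v ^+ n
    + x4 v * x0 v ^+ n + x5 v ^+ n.+1)) => // t.
  have := vanish (v + ((t - x1 v) / x1 e) *: e).
  rewrite /loop_fermat form_shift // !(form_shift_zero _ _ x0e).
  rewrite !(form_shift_zero _ _ x2e) !(form_shift_zero _ _ x3e).
  rewrite !(form_shift_zero _ _ x4e) (form_shift_zero _ _ x5e).
  by rewrite rpredD ?rpredZ // => <- //; ring.
have [W dimW memW] := hyperplane_section V x1.
have [|||z [zW /eqP zN0 [x3z x4z x5z]]] :=
    @exists_common_zero_binomial _ _ W n x3 x4 x5.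
- by rewrite -ltnS (leq_trans dimV).
- exact: ltnW.
- move=> v; rewrite memW => /andP[vV /eqP x1v]; have [x0v x2v] := x02 v vV.
  have := vanish v vV; rewrite /loop_fermat x0v x1v x2v expr0n.
  by rewrite (gtn_eqF (ltnW n1)) !(mul0r, mulr0, add0r, addr0).
move: zW; rewrite memW => /andP[zV /eqP x1z].
by have [x0z x2z] := x02 z zV; case: zN0; apply: inj.
Qed.

Lemma loop_fermat_vanishing_dim V n (x0 x1 x2 x3 x4 x5 : {scalar vT}) :
  (3 < n)%N -> jointly_injective V x0 x1 x2 x3 x4 x5 ->
  {in V, forall v,
    loop_fermat n (x0 v) (x1 v) (x2 v) (x3 v) (x4 v) (x5 v) = 0} ->
  (\dim V <= 2)%N.
Proof.
move=> n3 inj vanish; rewrite leqNgt; apply/negP => dimV.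
have n1 : (1 < n)%N by apply: ltn_trans n3.
have axis1 := loop_fermat_axis_eq0 dimV n1 inj vanish.
have axis4 : {in V, forall v, x3 v = 0 -> x0 v = 0 -> x1 v = 0 -> x2 v = 0 ->
    x5 v = 0 -> v = 0}.
  apply: (@loop_fermat_axis_eq0 V n x3 x4 x0 x1 x2 x5) => // v vV.
    by move=> x3v x4v x0v x1v x2v x5v; apply: inj.
  by rewrite -[RHS](vanish v vV) /loop_fermat; ring.
have [W dimW memW] := hyperplane_section V x0.
have dimW1 : (1 < \dim W)%N by rewrite -ltnS (leq_trans dimV).
have WV v : v \in W -> v \in V /\ x0 v = 0.
  by rewrite memW => /andP[vV /eqP].
have chain : {in W, forall v,
    chain_fermat n (x1 v) (x2 v) (x3 v) (x4 v) (x5 v) = 0}.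
  move=> v /WV[vV x0v]; rewrite -[RHS](vanish v vV) /loop_fermat x0v expr0n.
  by rewrite gtn_eqF 1?ltnW // mul0r mulr0 add0r addr0.
have [[z [zW /eqP zN0 x2z x3z]]|] :=
    exists_common_zero_or_dual_pair x2 x3 dimW1.
  have [x5z x4z] := chain_fermat_common_zero n1 chain zW x2z x3z.
  have [zV x0z] := WV z zW; case: x4z => [x4z|x3W]; first exact/zN0/axis1.
  have [||y [yW /eqP yN0 [x1y x2y x5y]]] :=
      @exists_common_zero_binomial _ _ W n x1 x2 x5 dimW1.
  - exact: ltnW.
  - move=> v vW; rewrite -[RHS](chain v vW) /chain_fermat x3W // expr0n.
    by rewrite gtn_eqF 1?ltnW // mul0r mulr0 !addr0.
  by have [yV x0y] := WV y yW; apply/yN0/axis4 => //; apply: x3W.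
case=> v [w [vW wW [x2v x3v] [x2w x3w]]].
exact: chain_fermat_no_dual_pair chain vW wW x2v x3v x2w x3w.
Qed.

End VanishingSubspaces.

Lemma dhomog1E (K : nzRingType) n (L : {mpoly K[n]}) :
  L \is 1.-homog -> L = \sum_i L@_U_(i) *: 'X_i.
Proof.
move=> /dhomogP hom; apply/mpolyP => m; rewrite raddf_sum /=.
under eq_bigr do rewrite mcoeffZ mcoeffX.
have [/mdeg1P[k /eqP->]|mN1] := boolP (mdeg m == 1%N).
  rewrite (bigD1 k) //= eqxx mulr1 big1 ?addr0 // => i ik.
  by rewrite eq_mnm1 (negPf ik) mulr0.
rewrite big1 => [|i _].
  by apply: memN_msupp_eq0; apply: contraNN mN1 => /hom ->.
have [mE|_] := eqVneq U_(i)%MM m; last by rewrite mulr0.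
by rewrite -mE mdeg1 in mN1.
Qed.

Lemma meval_dhomog1 (K : comNzRingType) n (L : {mpoly K[n]}) (v : 'I_n -> K) :
  L \is 1.-homog -> L.@[v] = \sum_i v i * L@_U_(i).
Proof.
move=> /dhomog1E {1}->; rewrite raddf_sum; apply: eq_bigr => i _ /=.
by rewrite mevalZ mevalXU mulrC.
Qed.

Lemma dhomogXU (K : nzRingType) n (i : 'I_n) :
  ('X_i : {mpoly K[n]}) \is 1.-homog.
Proof. by rewrite dhomogX /= mdeg1. Qed.

Lemma dhomogXUn (K : nzRingType) n (i : 'I_n) k :
  ('X_i ^+ k : {mpoly K[n]}) \is k.-homog.
Proof. by have := dhomogMn k (dhomogXU K i); rewrite mul1n. Qed.

Section SliceDecompositions.
Variable K : fieldType.

Lemma slice_decomposition_vanishing_subspace n r (F : {mpoly K[n]}) :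
  has_slice_decomposition F r ->
  exists2 V : {vspace 'rV[K]_n}, (n <= \dim V + r)%N &
    {in V, forall x : 'rV_n, F.@[x 0] = 0}.
Proof.
move=> [L [H [homL _ ->]]].
pose A : 'M[K]_(n, r) := \matrix_(i, k) (L k)@_U_(i).
pose f := linfun (mulmxr A : 'rV_n -> 'rV_r).
exists (lker f) => [|x].
  have dim_row m : \dim {:'rV[K]_m} = m by rewrite dimvf; apply: mul1n.
  have rank_f : (\dim (limg f) <= r)%N.
    by rewrite -[leqRHS]dim_row dimvS ?subvf.
  have := limg_ker_dim f fullv; rewrite capfv dim_row => rank_nullity.
  by rewrite -[leqLHS]rank_nullity leq_add2l.
rewrite memv_ker lfunE /= => /eqP/rowP xA.
rewrite raddf_sum big1 //= => k _; rewrite mevalM meval_dhomog1 //.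
have := xA k; rewrite !mxE; under eq_bigr do rewrite mxE.
by move=> ->; rewrite mul0r.
Qed.

Lemma has_slice_decomposition_S4 d : (1 < d)%N ->
  has_slice_decomposition (S4 K d) 4.
Proof.
case: d => [|[|d]] // _; pose x i : {mpoly K[6]} := 'X_(inord i).
exists (fun k : 'I_4 => nth 0 [:: x 1; x 3; x 4; x 5] k).
exists (fun k : 'I_4 => nth 0 [:: x 0 * x 1 ^+ d + x 2 ^+ d.+1;
  x 2 * x 3 ^+ d + x 4 ^+ d.+1; x 0 ^+ d.+1; x 5 ^+ d.+1] k).
have hom i j k : x i * x j ^+ d + x k ^+ d.+1 \is d.+1.-homog.
  rewrite rpredD ?dhomogXUn //.
  exact: dhomogM (dhomogXU _ _) (dhomogXUn _ _ _).
split.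
- by case=> [[|[|[|[|k]]]]] // k4; apply: dhomogXU.
- by case=> [[|[|[|[|k]]]]] // k4; exists d.+1; rewrite /= ?hom ?dhomogXUn.
rewrite !big_ord_recl big_ord0 /= /S4 subn1 /= -!/(x _) !exprS.
by ring.
Qed.

Lemma meval_S4 n (v : 'I_6 -> K) :
  (S4 K n.+1).@[v] = loop_fermat n (v (inord 0)) (v (inord 1)) (v (inord 2))
    (v (inord 3)) (v (inord 4)) (v (inord 5)).
Proof.
rewrite /S4 /loop_fermat subn1 /=.
have mevalXn (i : 'I_6) k : ('X_i ^+ k : {mpoly K[6]}).@[v] = v i ^+ k.
  by rewrite rmorphXn /= mevalXU.
by rewrite !(mevalD, mevalM) !mevalXn !mevalXU.
Qed.

End SliceDecompositions.

Section RowCoordinates.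
Variables (K : fieldType) (n : nat).

Definition row_coord (i : 'I_n) (x : 'rV[K]_n) : K := x 0 i.

Lemma row_coord_is_scalar i : scalar (row_coord i).
Proof. by move=> a x y; rewrite /row_coord !mxE. Qed.

HB.instance Definition _ (i : 'I_n) :=
  GRing.isLinear.Build K 'rV[K]_n K *%R (row_coord i) (row_coord_is_scalar i).

End RowCoordinates.

Lemma row_coord_jointly_injective (K : fieldType) (V : {vspace 'rV[K]_6}) :
  jointly_injective V (row_coord (inord 0)) (row_coord (inord 1))
    (row_coord (inord 2)) (row_coord (inord 3)) (row_coord (inord 4))
    (row_coord (inord 5)).
Proof.
move=> x _ x0 x1 x2 x3 x4 x5; apply/rowP => i; rewrite mxE -(inord_val i).
by case: i => [[|[|[|[|[|[|i]]]]]]].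
Qed.

Lemma S4_vanishing_dim (K : numFieldType) d (V : {vspace 'rV[K]_6}) :
  (5 <= d)%N -> {in V, forall x : 'rV_6, (S4 K d).@[x 0] = 0} ->
  (\dim V <= 2)%N.
Proof.
case: d => // n n4 vanish.
apply: loop_fermat_vanishing_dim n4 (@row_coord_jointly_injective K V) _.
move=> x xV.
by rewrite -[RHS](vanish x xV) meval_S4.
Qed.

Theorem theorem20 (R : realType) (d : nat) (hd : (5 <= d)%N) :
  is_slice_rank (S4 (complex R) d) 4.
Proof.
split=> [|s /slice_decomposition_vanishing_subspace[V dimV vanish]].
  by apply: has_slice_decomposition_S4; apply: leq_trans hd.
have V2 := S4_vanishing_dim hd vanish.
by rewrite -(leq_add2l 2) (leq_trans dimV) // leq_add2r.
Qed.
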